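(* For all integers $r\geq 2$ and $k\geq -1$ there exists a positive integer $N$ such that the following holds: if $M$ is a loopless matroid of rank $r$ on a finite ground set with $\mu(M)\geq N$, then the uniformity complex of $M$ is $k$-connected. (The minimal such $N$ is denoted $h_r(k)$.)
   Context: Let $M$ be a matroid of rank $r$ on a finite ground set $E$. A subset $S\subset E$ is uniform if $S$ is independent, or $|S|>r$ and every subset of $S$ of size at most $r$ is independent. The uniformity complex of $M$ is the simplicial complex on $E$ whose simplices are the uniform subsets. $\mu(M)$ denotes the maximum size of a uniform subset of $M$. A space is $k$-connected if every continuous map $\mathbb{S}^i\to X$ extends to $\mathbb{B}^{i+1}\to X$ for $i=-1,0,\dots,k$ ($(-1)$-connected means non-empty). *)

(* Defs.v *)
From HB Require Import structures.
From mathcomp Require Import all_boot all_order all_algebra.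
From mathcomp Require Import all_classical all_reals all_analysis.
Set Implicit Arguments.
Unset Strict Implicit.
Unset Printing Implicit Defensive.
Import Order.TTheory GRing.Theory Num.Theory.
Import numFieldNormedType.Exports.

Local Open Scope ring_scope.
Local Open Scope classical_set_scope.

Record matroid (E : finType) := Matroid {
  indep : pred {set E};
  indep_set0 : indep finset.set0;
  indep_subset : forall A B : {set E}, A \subset B -> indep B -> indep A;
  indep_augment : forall A B : {set E}, indep A -> indep B ->
    (#|A| < #|B|)%N -> exists2 e, e \in B :\: A & indep (e |: A) }.

Section matroid_notions.
Variables (E : finType) (M : matroid E).

Definition matroid_rank : nat := (\max_(A : {set E} | indep M A) #|A|)%N.

Definition loopless : Prop := forall e : E, indep M [set e]%SET.

Definition uniform_subset (S : {set E}) : bool :=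
  indep M S ||
  (matroid_rank < #|S|)%N &&
  [forall A : {set E},
     (A \subset S) && (#|A| <= matroid_rank)%N ==> indep M A].

Definition mu : nat := (\max_(S : {set E} | uniform_subset S) #|S|)%N.

End matroid_notions.

(* Following the usual convention for abstract complexes, the empty set may be
   a face, and an element of [E] need not be a vertex. *)
Record simplicial_complex (E : finType) := SimplicialComplex {
  face : pred {set E};
  face_subset : forall A B : {set E}, A \subset B -> face B -> face A }.

Lemma uniform_subsetS (E : finType) (M : matroid E) (A B : {set E}) :
  A \subset B -> uniform_subset M B -> uniform_subset M A.
Proof.
move=> AB /orP[iB|/andP[_ /forallP uB]]; apply/orP.
  by left; exact: indep_subset iB.
case: (leqP #|A| (matroid_rank M)) => [Ar|rA]; [left|right].
  by have /implyP := uB A; rewrite AB Ar; exact.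
apply/andP; split => //; apply/forallP => C; apply/implyP => /andP[CA Cr].
by have /implyP := uB C; rewrite (fintype.subset_trans CA AB) Cr; exact.
Qed.

Definition uniformity_complex (E : finType) (M : matroid E) :
  simplicial_complex E := SimplicialComplex (@uniform_subsetS E M).

(* Barycentric coordinates; since [E] is finite, the subspace topology from
   [{ptws E -> R}], i.e. from R^E, is the usual topology of the realization. *)
Definition realization (R : realType) (E : finType)
    (K : simplicial_complex E) : set {ptws E -> R} :=
  [set x : {ptws E -> R} | [/\ forall e, 0 <= x e,
                               \sum_(e : E) x e = 1 &
                               face K [set e | x e != 0]%SET]].
Arguments realization R {E} K.

(* The sphere of dimension n - 1 and the ball of dimension n that it bounds,
   both for the Euclidean norm (the library's norm on matrices is the sup norm).
*)
Definition unit_sphere (R : realType) (n : nat) : set 'rV[R]_n :=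
  [set x : 'rV[R]_n | \sum_(i < n) x 0 i ^+ 2 = 1].
Arguments unit_sphere : clear implicits.

Definition closed_unit_ball (R : realType) (n : nat) : set 'rV[R]_n :=
  [set x : 'rV[R]_n | \sum_(i < n) x 0 i ^+ 2 <= 1].
Arguments closed_unit_ball : clear implicits.

(* k-connectedness of the subspace [X] of [T]. The first conjunct is the case
   i = -1 (empty sphere, one-point ball). Maps on spheres and balls are encoded
   by total functions whose values elsewhere are irrelevant. *)
Definition k_connected (R : realType) (k : int) (T : topologicalType)
    (X : set T) : Prop :=
  (-1 <= k -> X !=set0) /\
  forall i : nat, i%:Z <= k ->
  forall f : 'rV[R]_i.+1 -> T,
    {within unit_sphere R i.+1, continuous f} ->
    (forall x, unit_sphere R i.+1 x -> X (f x)) ->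
    exists g : 'rV[R]_i.+1 -> T,
      [/\ {within closed_unit_ball R i.+1, continuous g},
          forall x, closed_unit_ball R i.+1 x -> X (g x) &
          forall x, unit_sphere R i.+1 x -> g x = f x].
Arguments k_connected R k {T} X.

(* Main.v *)
(* Let [S] be a large uniform set. An independent set [A] of size less than the
   rank spans at most [#|A|] elements of [S], so over any small set of vertices
   [S] contains a common cone point for all uniform subsets. Given [f] on the
   sphere, take a fine grid partition of unity [phi_z] such that some vertex
   [w z] carries positive weight in [f] throughout the support of [phi_z].
   Every grid cell has at most [3 ^ n] neighbours, whence cone points [s z] in
   [S] can be chosen greedily so that the vertices [w z] and [s z] active at a
   common point always span a face. Thus [f] moves along segments to
   [sum phi_z w_z], then to [sum phi_z s_z], which lies in the simplex on [S]
   and contracts there. *)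
Require Import Defs.
From mathcomp Require Import all_boot all_order all_algebra.
Set Implicit Arguments.
Unset Strict Implicit.
Unset Printing Implicit Defensive.

(** * Cone points over small vertex sets in a matroid *)

Section Matroid.
Variables (E : finType) (M : matroid E).
Implicit Types (A B S W : {set E}).

Lemma uniform_subsetP S :
  reflect (forall A, A \subset S -> #|A| <= matroid_rank M -> indep M A)
          (uniform_subset M S).
Proof.
apply: (iffP idP) => [/orP[iS A AS _|/andP[_ /forallP uS] A AS Ar]|uS].
- exact: indep_subset iS.
- by have /implyP := uS A; rewrite AS Ar; exact.
- case: (leqP #|S| (matroid_rank M)) => Sr; apply/orP; [left|right].
    exact: uS.
  by rewrite Sr; apply/forallP => A; apply/implyP => /andP[/uS]; apply.
Qed.

(** Any [#|A| + 1] elements of the uniform set [S] are independent, as [#|A|] is below the rank.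
    Augmentation would then find one among them that keeps [A] independent. *)
Lemma card_dependent_extension S A : uniform_subset M S -> indep M A ->
  #|A| < matroid_rank M -> #|[set v in S | ~~ indep M (v |: A)]| <= #|A|.
Proof.
move=> /uniform_subsetP uS iA Ar; rewrite leqNgt; apply/negP => lt.
have [B sB cB] : exists2 B : {set E},
    B \subset [set v in S | ~~ indep M (v |: A)] & #|B| = #|A|.+1.
  have /set0Pn[B] : [set B : {set E} |
      (B \subset [set v in S | ~~ indep M (v |: A)]) && (#|B| == #|A|.+1)]
      != set0.
    by rewrite -card_gt0 cards_draws bin_gt0.
  by rewrite inE => /andP[sB /eqP cB]; exists B.
have iB : indep M B.
  apply: uS; last by rewrite cB.
  by apply: (subset_trans sB); apply/subsetP => v; rewrite inE => /andP[].
have [|e /setDP[/(subsetP sB)]] := indep_augment iA iB; first by rewrite cB.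
by rewrite inE => /andP[_ /negbTE->].
Qed.

(** Union bound: each independent subset of [W] of size below the rank rules out fewer elements of
    [S] than the rank, and [W] has [2 ^ #|W|] subsets. An element [v] ruled out by none is a cone
    point, because a test set [B] through [v] leaves such a subset [B :\ v]. *)
Lemma uniform_cone_point S W : uniform_subset M S ->
    matroid_rank M * 2 ^ #|W| < #|S| ->
  exists2 v, v \in S &
    forall A, A \subset W -> uniform_subset M A -> uniform_subset M (v |: A).
Proof.
move=> uS WS.
pose good (A : {set E}) := indep M A && (#|A| < matroid_rank M).
pose D (A : {set E}) := [set v in S | ~~ indep M (v |: A)].
have : #|\bigcup_(A in powerset W | good A) D A| < #|S|.
  apply: leq_ltn_trans WS.
  apply: leq_trans (_ : \sum_(A in powerset W | good A) #|D A| <= _).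
    elim/big_rec2: _ => [|A n B _ le]; first by rewrite cards0.
    by apply: leq_trans (leq_card_setU _ _) _; rewrite leq_add2l.
  rewrite -card_powerset mulnC -sum_nat_const big_mkcondr /=.
  apply: leq_sum => A _; case: ifP => // /andP[iA Ar].
  exact: leq_trans (card_dependent_extension uS iA Ar) (ltnW Ar).
rewrite ltnNge => nle.
have /subsetPn[v vS vD] : ~~ (S \subset \bigcup_(A in powerset W | good A) D A).
  by apply: contra nle; exact: subset_leq_card.
exists v => // A AW /uniform_subsetP uA; apply/uniform_subsetP => B BvA Br.
have BvSA : B :\ v \subset A by rewrite subDset.
have [vB|vB] := boolP (v \in B); last first.
  apply: uA => //; apply/subsetP => x xB; have := subsetP BvA _ xB.
  by case/setU1P => // xv; rewrite xv (negbTE vB) in xB.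
have cB : #|B :\ v| < matroid_rank M by move: Br; rewrite (cardsD1 v) vB.
rewrite -(setD1K vB); apply: contraNT vD => nB; apply/bigcupP.
exists (B :\ v); last by rewrite inE vS.
by rewrite powersetE (subset_trans BvSA AW) /good cB uA // ltnW.
Qed.

(* Greedy choice: the indices are treated one at a time, each new vertex [s i]
   being a cone point over all vertices attached so far to neighbours of [i]. *)
Lemma uniform_clique_extension (I : finType) (adj : rel I) (D : nat)
    (w : I -> E) S :
    (forall i, #|[set j | adj i j]| <= D) -> uniform_subset M S ->
    matroid_rank M * 2 ^ (2 * D) < #|S| ->
  exists2 s : I -> E, (forall i, s i \in S) &
    forall C : {set I}, {in C &, forall i j, adj i j} ->
      uniform_subset M (w @: C) -> uniform_subset M (w @: C :|: s @: C).
Proof.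
move=> degD uS DS.
have [v0 v0S] : exists v, v \in S.
  by apply/set0Pn; rewrite -card_gt0; apply: leq_ltn_trans DS.
(* Restricting the claim to the indices already treated allows induction along [enum I]. *)
suff [s sS sC] : exists2 s : I -> E, (forall i, s i \in S) &
    forall C : {set I}, {in C &, forall i j, adj i j} ->
      uniform_subset M (w @: C) ->
      uniform_subset M (w @: C :|: s @: (C :&: [set i in enum I])).
  exists s => // C clC uC; have := sC C clC uC.
  suff -> : C :&: [set i in enum I] = C by [].
  by apply/setP => i; rewrite !inE mem_enum andbT.
elim: (enum I) => [|i l [s sS sC]].
  exists (fun=> v0) => // C _ uC.
  suff -> : C :&: [set i in [::]] = set0 by rewrite imset0 setU0.
  by apply/setP => i; rewrite !inE andbF.
pose N := [set j | adj i j].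
(* Each neighbour of [i] contributes one [w] and one [s] vertex, hence the exponent [2 * D]. *)
have [|v vS vN] := @uniform_cone_point S (w @: N :|: s @: N) uS.
  apply: leq_ltn_trans DS; rewrite leq_mul2l leq_exp2l //.
  rewrite (leq_trans (leq_card_setU _ _)) ?orbT // mul2n -addnn.
  by rewrite leq_add // (leq_trans (leq_imset_card _ _)) // degD.
pose s' j := if j == i then v else s j.
exists s' => [j|C clC uC]; first by rewrite /s'; case: ifP.
have [iC|iC] := boolP (i \in C); last first.
  suff -> : s' @: (C :&: [set j in i :: l]) = s @: (C :&: [set j in l]).
    exact: sC.
  have -> : C :&: [set j in i :: l] = C :&: [set j in l].
    apply/setP => j; rewrite !inE; case: eqP => //= ->.
    by rewrite (negbTE iC).
  apply: eq_in_imset => j; rewrite !inE /s' => /andP[jC _].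
  by case: eqP => // ji; rewrite -ji jC in iC.
(* A clique through [i] consists of neighbours of [i], so the vertices attached to it lie in the set
   over which [v] is a cone point. *)
have CN : C \subset N by apply/subsetP => j jC; rewrite inE clC.
apply: (uniform_subsetS (B := v |: (w @: C :|: s @: (C :&: [set j in l])))).
  rewrite setUCA; apply: setUS; apply/subsetP => _ /imsetP[j + ->].
  rewrite !inE /s' => /andP[jC]; case: eqP => [_ _|_ jl]; first by rewrite eqxx.
  by apply/orP; right; apply: imset_f; rewrite !inE jC.
apply: vN; last exact: sC.
apply: setUSS; apply: imsetS => //.
by apply: subset_trans CN; exact: subsetIl.
Qed.

End Matroid.

From mathcomp Require Import all_classical all_reals all_analysis.
From mathcomp Require Import zify ring lra.
Import Order.TTheory GRing.Theory Num.Theory.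
Import numFieldNormedType.Exports.

Local Open Scope ring_scope.
Local Open Scope classical_set_scope.


(** * A grid partition of unity on the cube *)

Section Grid.
Variable R : realType.
Implicit Types t : R.

Definition hat t : R := Num.max 0 (1 - `|t|).

Lemma hat_ge0 t : 0 <= hat t.
Proof. by rewrite /hat le_max lexx. Qed.

Lemma hat_neq0 t : hat t != 0 -> `|t| < 1.
Proof.
rewrite /hat; apply: contra_neqT; rewrite -leNgt => t1.
by apply/max_idPl; lra.
Qed.

Lemma hat_eq0 t : 1 <= `|t| -> hat t = 0.
Proof. by move=> t1; apply/max_idPl; lra. Qed.

Lemma hatE t : `|t| <= 1 -> hat t = 1 - `|t|.
Proof. by move=> t1; apply/max_idPr; lra. Qed.

Lemma hat_continuous : continuous hat.
Proof.
move=> t; apply: (@continuous_max _ _ (fun=> 0) (fun t => 1 - `|t|)).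
  exact: cvg_cst.
by apply: cvgB; [exact: cvg_cst|apply: cvg_norm; exact: cvg_id].
Qed.

(** Between consecutive integers only two tents are non-zero, with complementary values [1 - t] and
    [t]. In the induction the new tent matters only for [y] beyond [N], where only the last two
    survive. *)
Lemma sum_hat (N : nat) (y : R) : 0 <= y -> y <= N%:R ->
  \sum_(a < N.+1) hat (y - a%:R) = 1.
Proof.
elim: N => [|N IH] y0 yN.
  have -> : y = 0 by apply/eqP; rewrite eq_le y0 yN.
  by rewrite big_ord1 subr0 hatE normr0 ?subr0.
have NS : N.+1%:R = N%:R + 1 :> R by rewrite -natr1.
rewrite NS in yN; rewrite big_ord_recr /= NS; have [leyN|ltNy] := leP y N%:R.
  by rewrite IH // hat_eq0 ?addr0 // ler0_norm; lra.
rewrite big_ord_recr big1 /= => [|a _].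
  by rewrite !hatE ?[`|y - N%:R|]ger0_norm ?[`|y - (_ + _)|]ler0_norm; lra.
have : a.+1%:R <= N%:R :> R by rewrite ler_nat.
by rewrite -natr1 => aN; rewrite hat_eq0 // ger0_norm; lra.
Qed.

Variables n m : nat.

(** The entry [z j] stands for the coordinate [(z j - m) / m]: the indices are the points of the
    grid of mesh [1 / m] on the cube [[-1, 1]^n]. *)
Definition grid_index := {ffun 'I_n -> 'I_(2 * m).+1}.

Definition grid_adj (z z' : grid_index) : bool :=
  [forall j, (z j <= (z' j).+1)%N && (z' j <= (z j).+1)%N].

Lemma card_grid_adj z : (#|[set z' | grid_adj z z']%SET| <= 3 ^ n)%N.
Proof.
pose F j := [pred a : 'I_(2 * m).+1 | (z j <= a.+1)%N && (a <= (z j).+1)%N].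
have -> : #|[set z' | grid_adj z z']%SET| =
    #|(family F : simpl_pred grid_index)|.
  by apply: eq_card => z'; rewrite inE; apply/forallP/familyP.
rewrite card_family.
have card3 j : (#|F j| <= 3)%N.
  (* The admissible [a] lie among [z j - 1], [z j], [z j + 1]; adding one before subtracting avoids
     truncation at zero. *)
  pose h (a : 'I_(2 * m).+1) : 'I_3 := inord (a.+1 - z j).
  rewrite -[3%N]card_ord -(@card_in_imset _ _ h (F j)); last first.
    move=> a b; rewrite !inE => /andP[? ?] /andP[? ?] /(congr1 val).
    rewrite /h /= !inordK; [|lia..] => ab; apply: val_inj => /=; lia.
  exact: max_card.
rewrite foldrE big_image /= -[X in (3 ^ X)%N]card_ord -prod_nat_const.
by apply: leq_prod => j _; exact: card3.
Qed.

Definition grid_fun (z : grid_index) (x : 'rV[R]_n) : R :=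
  \prod_(j < n) hat (m%:R * x 0 j + m%:R - (z j)%:R).

Lemma grid_fun_ge0 z x : 0 <= grid_fun z x.
Proof. by apply: prodr_ge0 => j _; exact: hat_ge0. Qed.

Lemma grid_fun_neq0 z x : grid_fun z x != 0 ->
  forall j, `|m%:R * x 0 j + m%:R - (z j)%:R| < 1.
Proof. by move=> /prodf_neq0 h j; apply/hat_neq0/h. Qed.

Lemma cvg_grid_fun z (T : Type) (F : set_system T) {FF : Filter F}
    (u : T -> 'rV[R]_n) (x : 'rV[R]_n) :
  (forall j, u t 0 j @[t --> F] --> x 0 j) ->
  grid_fun z (u t) @[t --> F] --> grid_fun z x.
Proof.
move=> ux; apply: cvg_big => [|j _]; first exact: mul_continuous.
apply: continuous_cvg; first exact: hat_continuous.
apply: cvgB; last exact: cvg_cst.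
apply: cvgD; last exact: cvg_cst.
by apply: cvgM; [exact: cvg_cst|exact: ux].
Qed.

(** Distributivity turns the sum of products into a product of one-dimensional sums, each equal to 1
    by [sum_hat]. *)
Lemma sum_grid_fun (x : 'rV[R]_n) : (forall j, `|x 0 j| <= 1) ->
  \sum_z grid_fun z x = 1.
Proof.
move=> x1; rewrite /grid_fun.
rewrite -(bigA_distr_bigA (fun j (a : 'I_(2 * m).+1) =>
  hat (m%:R * x 0 j + m%:R - a%:R))).
have mR0 : 0 <= m%:R :> R by [].
rewrite big1 // => j _; have := x1 j; rewrite ler_norml => /andP[? ?].
by apply: sum_hat; rewrite ?natrM; nra.
Qed.

(** Two integers at distance less than 1 from the same real differ by at most 1. *)
Lemma grid_fun_adj z z' x : grid_fun z x != 0 -> grid_fun z' x != 0 ->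
  grid_adj z z'.
Proof.
move=> /grid_fun_neq0 h /grid_fun_neq0 h'; apply/forallP => j.
have {h} := h j; have {h'} := h' j; rewrite !ltr_norml => /andP[? ?] /andP[? ?].
by rewrite -ltnS -(ltr_nat R) -[X in _ && X]ltnS -(ltr_nat R) -!natr1; lra.
Qed.

Lemma grid_fun_close z x y : (0 < m)%N ->
  grid_fun z x != 0 -> grid_fun z y != 0 ->
  forall j, `|x 0 j - y 0 j| < 2 / m%:R.
Proof.
move=> m0 /grid_fun_neq0 hx /grid_fun_neq0 hy j.
have {hx} := hx j; have {hy} := hy j.
have m0R : 0 < m%:R :> R by rewrite ltr0n.
rewrite ltr_pdivlMr // -(gtr0_norm m0R) -normrM (gtr0_norm m0R).
by rewrite !ltr_norml => /andP[? ?] /andP[? ?]; lra.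
Qed.

End Grid.

(** * Coordinatewise convergence and the Euclidean sphere *)

Lemma cvg_ptws (R : realType) (E T : Type) (F : set_system T) {FF : Filter F}
    (g : T -> {ptws E -> R}) (l : {ptws E -> R}) :
  (forall e, g t e @[t --> F] --> l e) -> g t @[t --> F] --> l.
Proof.
move=> gl; apply/cvg_sup => e A [B [[C oC CB] Bl] BA].
apply: filterS BA _; rewrite -CB; apply: (gl e); apply: open_nbhs_nbhs.
by split => //; move: Bl; rewrite -CB.
Qed.

Lemma ptws_coord_cvg (R : realType) (E : eqType) (T : Type)
    (F : set_system T) {FF : Filter F}
    (g : T -> {ptws E -> R}) (l : {ptws E -> R}) (e : E) :
  g t @[t --> F] --> l -> g t e @[t --> F] --> l e.
Proof.
move=> gl; have c := @proj_continuous E (fun=> R) e l.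
exact: (cvg_comp _ _ gl c).
Qed.


Section Euclidean.
Variables (R : realType) (n : nat).
Implicit Types x y : 'rV[R]_n.

Lemma cvg_rV (T : Type) (F : set_system T) {FF : Filter F}
    (u : T -> 'rV[R]_n) x :
  (forall j, u t 0 j @[t --> F] --> x 0 j) -> u t @[t --> F] --> x.
Proof.
move=> ux; apply/cvg_ballP => e e0.
have : \forall t \near F, forall j, ball (x 0 j) e (u t 0 j).
  by apply: filter_forall => j; exact: cvg_ball (ux j) _ e0.
by apply: filterS => t h; split => // i j; rewrite ord1.
Qed.

Definition enorm x : R := Num.sqrt (\sum_(j < n) x 0 j ^+ 2).

Lemma cvg_sumsq (T : Type) (F : set_system T) {FF : Filter F}
    (u : T -> 'rV[R]_n) x : (forall j, u t 0 j @[t --> F] --> x 0 j) ->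
  \sum_(j < n) u t 0 j ^+ 2 @[t --> F] --> \sum_(j < n) x 0 j ^+ 2.
Proof.
move=> ux; apply: cvg_big => [|j _]; first exact: add_continuous.
exact: cvgM (ux j) (ux j).
Qed.

Lemma cvg_enorm (T : Type) (F : set_system T) {FF : Filter F}
    (u : T -> 'rV[R]_n) x : (forall j, u t 0 j @[t --> F] --> x 0 j) ->
  enorm (u t) @[t --> F] --> enorm x.
Proof.
move=> ux; rewrite /enorm; apply: continuous_cvg; first exact: sqrt_continuous.
exact: cvg_sumsq.
Qed.

Lemma unit_sphereE x : unit_sphere R n x -> enorm x = 1.
Proof. by rewrite /unit_sphere /enorm /= => ->; rewrite sqrtr1. Qed.

Definition normalize x : 'rV[R]_n := (enorm x)^-1 *: x.

Lemma normalize_sphere x : enorm x != 0 -> unit_sphere R n (normalize x).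
Proof.
move=> x0; rewrite /unit_sphere /=.
under eq_bigr do rewrite mxE exprMn.
rewrite -mulr_sumr exprVn sqr_sqrtr; last first.
  by apply: sumr_ge0 => j _; exact: sqr_ge0.
by rewrite mulVf //; apply: contraNneq x0; rewrite /enorm => ->; rewrite sqrtr0.
Qed.

Lemma normalize_id x : unit_sphere R n x -> normalize x = x.
Proof. by move=> /unit_sphereE xS; rewrite /normalize xS invr1 scale1r. Qed.

Lemma cvg_normalize (T : Type) (F : set_system T) {FF : Filter F}
    (u : T -> 'rV[R]_n) x : enorm x != 0 ->
  (forall j, u t 0 j @[t --> F] --> x 0 j) ->
  forall j, normalize (u t) 0 j @[t --> F] --> normalize x 0 j.
Proof.
move=> x0 ux j; rewrite /normalize mxE; under eq_cvg do rewrite mxE.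
by apply: cvgM; [apply: cvgV => //; exact: cvg_enorm|exact: ux].
Qed.

Lemma unit_sphere_coord x j : unit_sphere R n x -> `|x 0 j| <= 1.
Proof.
move=> xS; rewrite -(@ler_pXn2r _ 2) ?nnegrE // expr1n real_normK ?num_real //.
rewrite -xS (bigD1 j) //= lerDl; apply: sumr_ge0 => i _; exact: sqr_ge0.
Qed.

Lemma unit_sphere_compact : compact (unit_sphere R n).
Proof.
apply: (@subclosed_compact _ _
  [set v : 'rV[R]_n | forall j, `[(-1 : R), 1]%classic (v ord0 j)]).
- apply: (@preimage_closed _ _ (fun x : 'rV[R]_n => \sum_(j < n) x 0 j ^+ 2)
      [set 1]); last first.
    exact/accessible_closed_set1/hausdorff_accessible/Rhausdorff.
  move=> x _; apply: (@cvg_sumsq _ (nbhs x) _ id) => j; exact: coord_continuous.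
- apply: (@rV_compact _ _ (fun=> `[(-1 : R), 1]%classic)).
  by move=> _; exact: segment_compact.
- by move=> x xS j; rewrite /= in_itv /= -ler_norml; exact: unit_sphere_coord.
Qed.

(** Uniform continuity from compactness. The tolerance [2 / m] is the bound of [grid_fun_close] on
    the width of the support of a grid function. *)
Lemma unit_sphere_unif_continuous (E : finType)
    (f : 'rV[R]_n -> {ptws E -> R}) (eps : R) : 0 < eps ->
  {within unit_sphere R n, continuous f} ->
  exists2 m, (0 < m)%N & forall x y, unit_sphere R n x -> unit_sphere R n y ->
    (forall j, `|x 0 j - y 0 j| < 2 / m%:R) ->
    forall e, `|f x e - f y e| < eps.
Proof.
move=> eps0 /subspace_continuousP fc.
(* Using [m.+1] keeps the denominator non-zero for every natural [m]. *)
pose P (m : nat) x := forall y, unit_sphere R n y ->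
    (forall j, `|x 0 j - y 0 j| < 2 / m.+1%:R) ->
    forall e, `|f x e - f y e| < eps.
have cov : forall x, unit_sphere R n x ->
    \forall x' \near x & m \near \oo, unit_sphere R n x' -> P m x'.
  move=> x xS.
  have : \forall y \near within (unit_sphere R n) (nbhs x),
      forall e, `|f x e - f y e| < eps / 2.
    apply: filter_forall => e.
    have fe : f y e @[y --> within (unit_sphere R n) (nbhs x)] --> f x e.
      exact: ptws_coord_cvg (fc x xS).
    have e2 : 0 < eps / 2 by rewrite divr_gt0.
    exact: (@cvgr_dist_lt R R^o _ _ _ (fun y => f y e) _ fe _ e2).
  move=> /nbhs_ballP[d /= d0 dP].
  (* With [x'] within [d / 2] of [x] and [2 / m.+1 < d / 2], both [x'] and [y] fall in the ball of
     radius [d], where [f] is within [eps / 2] of [f x]. *)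
  exists (ball x (d / 2), [set m | m.+1%:R^-1 < d / 4]) => /=.
    split; first by apply: nbhsx_ballx; rewrite divr_gt0.
    have d4 : 0 < d / 4 by rewrite divr_gt0.
    exact: (near_infty_natSinv_lt (PosNum d4)).
  move=> [x' m] /= [[_ xx'] md] x'S y yS x'y e.
  have x'e : `|f x e - f x' e| < eps / 2.
    apply: (dP x') => //; split => // i j; have := xx' i j.
    by rewrite /ball /=; lra.
  have ye : `|f x e - f y e| < eps / 2.
    apply: (dP y) => //; split => // i j; have := xx' i j; have := x'y j.
    rewrite (ord1 i) /ball /= => h1 h2.
    rewrite (le_lt_trans (ler_distD (x' 0 j) _ _)) //.
    move: md h1; set q := _^-1; lra.
  by rewrite (le_lt_trans (ler_distD (f x e) _ _)) // distrC; lra.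
have /compact_near_coveringP/(_ _ _ _ _ cov) := unit_sphere_compact.
move=> [m _ /(_ m (leqnn m)) mP]; exists m.+1 => // x y xS.
exact: (mP x xS xS y).
Qed.

End Euclidean.


(** * Barycentric coordinates and simplices *)

Section Barycentric.
Variables (R : realType) (E : finType).
Implicit Types (A B : {set E}) (p q : {ptws E -> R}).

(** The support may be smaller than [A], so that points with different supports can share a simplex
    and be joined by a segment in it. *)
Definition in_simplex A p : Prop :=
  [/\ forall e, 0 <= p e, \sum_e p e = 1 & forall e, e \notin A -> p e = 0].

Lemma in_simplexS A B p : A \subset B -> in_simplex A p -> in_simplex B p.
Proof.
move=> AB [p0 p1 pA]; split => // e eB; apply: pA.
by apply: contra eB; exact: (fintype.subsetP AB).
Qed.

Lemma in_simplex_realization (K : simplicial_complex E) A p :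
  face K A -> in_simplex A p -> realization R K p.
Proof.
move=> KA [p0 p1 pA]; split => //; apply: face_subset KA.
apply/fintype.subsetP => e; rewrite inE; apply: contraNT => /pA ->.
by rewrite eqxx.
Qed.

Lemma realization_in_simplex (K : simplicial_complex E) p :
  realization R K p -> in_simplex [set e | p e != 0]%SET p.
Proof. by move=> [p0 p1 _]; split => // e; rewrite inE negbK => /eqP. Qed.

Lemma in_simplex_conv A p q (t : R) : 0 <= t <= 1 ->
  in_simplex A p -> in_simplex A q ->
  in_simplex A (fun e => t * p e + (1 - t) * q e).
Proof.
move=> /andP[t0 t1] [p0 p1 pA] [q0 q1 qA]; split => [e||e eA].
- by rewrite addr_ge0 ?mulr_ge0 ?subr_ge0.
- by rewrite big_split /= -!mulr_sumr p1 q1; ring.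
- by rewrite pA // qA // !mulr0 addr0.
Qed.

Definition vertex_point (v : E) : {ptws E -> R} := fun e => (e == v)%:R.

Lemma vertex_point_in_simplex v : in_simplex [set v]%SET (vertex_point v).
Proof.
split => [e||e]; rewrite /vertex_point ?ler0n //.
  by rewrite (bigD1 v) //= eqxx big1 ?addr0 // => e /negbTE ->.
by rewrite inE => /negbTE ->.
Qed.

(** The convex combination of the vertices [w i] with weights [phi i]; indices with the same vertex
    add their weights. *)
Definition spread (I : finType) (phi : I -> R) (w : I -> E) : {ptws E -> R} :=
  fun e => \sum_(i | w i == e) phi i.

Lemma spread_in_simplex (I : finType) (phi : I -> R) (w : I -> E) :
  (forall i, 0 <= phi i) -> \sum_i phi i = 1 ->
  in_simplex (w @: [set i | phi i != 0])%SET (spread phi w).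
Proof.
move=> phi0 phi1; split => [e||e eA]; first exact: sumr_ge0.
  by rewrite -phi1 (partition_big w xpredT).
rewrite /spread big1 // => i /eqP wi; apply/eqP; apply: contraNT eA => phii.
by apply/imsetP; exists i; rewrite ?inE.
Qed.

End Barycentric.

(** * Radial filling of the ball *)

Section Clamp.
Variable R : realType.
Implicit Types t : R.

Definition clamp t : R := Num.max 0 (Num.min 1 t).

Lemma clamp_eq0 t : t <= 0 -> clamp t = 0.
Proof.
by move=> t0; rewrite /clamp; case: (leP 1 t) => ?; apply/max_idPl; lra.
Qed.

Lemma clamp_eq1 t : 1 <= t -> clamp t = 1.
Proof. by move=> t1; rewrite /clamp (min_idPl t1); apply/max_idPr; lra. Qed.

Lemma clamp_itv t : 0 <= clamp t <= 1.
Proof.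
by rewrite /clamp le_max lexx ge_max ler01 ge_min lexx.
Qed.

Lemma clamp_continuous : continuous clamp.
Proof.
move=> t; apply: (@continuous_max _ _ (fun=> 0) (fun t => Num.min 1 t)).
  exact: cvg_cst.
by apply: (@continuous_min _ _ (fun=> 1) id); [exact: cvg_cst|exact: cvg_id].
Qed.

End Clamp.

Section Filling.
Variables (R : realType) (E : finType) (n : nat).
Variables (f h s : 'rV[R]_n -> {ptws E -> R}) (p : {ptws E -> R}).

(* On the ray through a point [u] of the sphere this is the broken line
   [p], [s u], [h u], [f u], at radii 1/4, 1/2, 3/4, 1. *)
Definition filling (x : 'rV[R]_n) : {ptws E -> R} :=
  let u := normalize x in
  let a := clamp (4 * enorm x - 1) in
  let b := clamp (4 * enorm x - 2) in
  let c := clamp (4 * enorm x - 3) in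
  fun e => c * f u e + (b - c) * h u e + (a - b) * s u e + (1 - a) * p e.

Lemma filling_inner x : enorm x <= 1/4 -> filling x = p.
Proof.
move=> x1; apply/funext => e; rewrite /filling !clamp_eq0; lra.
Qed.

Lemma filling_sphere x : unit_sphere R n x -> filling x = f x.
Proof.
move=> xS; apply/funext => e.
rewrite /filling normalize_id // unit_sphereE // !clamp_eq1; lra.
Qed.

(** At each radius at most two consecutive corners of the broken line carry weight, and the
    hypotheses put each such pair in a common face. *)
Lemma filling_realization (K : simplicial_complex E) (S : {set E}) x :
  face K S -> in_simplex S p ->
  (forall u, unit_sphere R n u -> in_simplex S (s u)) ->
  (forall u, unit_sphere R n u ->
     exists2 A, face K A & in_simplex A (s u) /\ in_simplex A (h u)) ->
  (forall u, unit_sphere R n u ->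
     exists2 A, face K A & in_simplex A (h u) /\ in_simplex A (f u)) ->
  realization R K (filling x).
Proof.
move=> KS pS sS shA hfA; have [x4|x4] := leP (enorm x) (1/4).
  by rewrite filling_inner //; exact: in_simplex_realization KS pS.
have xS : unit_sphere R n (normalize x) by apply: normalize_sphere; lra.
have [x2|x2] := leP (enorm x) (1/2).
  apply: in_simplex_realization KS _.
  have := in_simplex_conv (clamp_itv (4 * enorm x - 1)) (sS _ xS) pS.
  congr in_simplex; apply/funext => e; rewrite /filling.
  by rewrite (@clamp_eq0 _ (_ - 2)) 1?(@clamp_eq0 _ (_ - 3)); lra.
have [x3|x3] := leP (enorm x) (3/4).
  have [A KA [sA hA]] := shA _ xS; apply: in_simplex_realization KA _.
  have := in_simplex_conv (clamp_itv (4 * enorm x - 2)) hA sA.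
  congr in_simplex; apply/funext => e; rewrite /filling.
  by rewrite (@clamp_eq1 _ (_ - 1)) 1?(@clamp_eq0 _ (_ - 3)); lra.
have [A KA [hA fA]] := hfA _ xS; apply: in_simplex_realization KA _.
have := in_simplex_conv (clamp_itv (4 * enorm x - 3)) fA hA.
congr in_simplex; apply/funext => e; rewrite /filling.
by rewrite (@clamp_eq1 _ (_ - 1)) 1?(@clamp_eq1 _ (_ - 2)); lra.
Qed.

(** Continuity of [f] is known only along the sphere, so the limit is taken where [normalize (v t)]
    lies on it, that is, once [enorm (v t)] is non-zero. *)
Lemma cvg_comp_normalize (T : Type) (F : set_system T) {FF : Filter F}
    (v : T -> 'rV[R]_n) x : {within unit_sphere R n, continuous f} ->
  enorm x != 0 -> (forall j, v t 0 j @[t --> F] --> x 0 j) ->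
  f (normalize (v t)) @[t --> F] --> f (normalize x).
Proof.
move=> /subspace_continuousP fc x0 vx A fA.
have nx : normalize (v t) @[t --> F] --> normalize x.
  by apply: cvg_rV => j; exact: cvg_normalize.
have H1 := nx _ (fc _ (normalize_sphere x0) _ fA).
have H2 : \forall t \near F, enorm (v t) != 0.
  exact: (@cvgr_neq0 R R^o _ _ _ (fun t => enorm (v t)) _ (cvg_enorm vx) x0).
apply: (@filterS2 _ F _ _ _ _ _ H2 H1) => t t0; apply.
exact: normalize_sphere.
Qed.

Lemma cvg_filling (T : Type) (F : set_system T) {FF : Filter F}
    (v : T -> 'rV[R]_n) (x : 'rV[R]_n) (e : E) :
  {within unit_sphere R n, continuous f} ->
  (forall u : T -> 'rV[R]_n,
     (forall j, u t 0 j @[t --> F] --> normalize x 0 j) ->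
     s (u t) e @[t --> F] --> s (normalize x) e) ->
  (forall u : T -> 'rV[R]_n,
     (forall j, u t 0 j @[t --> F] --> normalize x 0 j) ->
     h (u t) e @[t --> F] --> h (normalize x) e) ->
  (forall j, v t 0 j @[t --> F] --> x 0 j) ->
  filling (v t) e @[t --> F] --> filling x e.
Proof.
move=> fc sc hc vx; have nv := @cvg_enorm _ _ _ _ FF _ _ vx.
(* Around the origin, where [normalize] gives no control, the filling is constantly [p]. *)
have [x4|x4] := ltP (enorm x) (1/4).
  rewrite filling_inner ?ltW //; apply: cvg_near_cst.
  have vlt : \forall t \near F, enorm (v t) < 1/4 by exact: (cvgr_lt _ nv).
  by apply: filterS vlt => t t4; rewrite filling_inner // ltW.
have x0 : enorm x != 0 by lra.
have clc (k : R) :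
    clamp (4 * enorm (v t) - k) @[t --> F] --> clamp (4 * enorm x - k).
  apply: continuous_cvg; first exact: clamp_continuous.
  by apply: cvgB; [apply: cvgM; [exact: cvg_cst|exact: nv]|exact: cvg_cst].
have nc := @cvg_normalize _ _ _ _ FF _ _ x0 vx.
rewrite /filling; apply: cvgD; last first.
  by apply: cvgM; [apply: cvgB; [exact: cvg_cst|exact: clc]|exact: cvg_cst].
apply: cvgD; last by apply: cvgM; [apply: cvgB; exact: clc|exact: sc].
apply: cvgD; last by apply: cvgM; [apply: cvgB; exact: clc|exact: hc].
apply: cvgM; first exact: clc.
apply: (@ptws_coord_cvg R _ T F FF (fun t => f (normalize (v t)))).
exact: cvg_comp_normalize.
Qed.

End Filling.

(** * Extending sphere maps into the uniformity complex *)

Lemma cvg_spread_grid (R : realType) (E : finType) (n m : nat)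
    (w : grid_index n m -> E) (T : Type) (F : set_system T) {FF : Filter F}
    (u : T -> 'rV[R]_n) (x : 'rV[R]_n) (e : E) :
  (forall j, u t 0 j @[t --> F] --> x 0 j) ->
  spread ((@grid_fun R n m)^~ (u t)) w e @[t --> F] -->
  spread ((@grid_fun R n m)^~ x) w e.
Proof.
move=> ux; apply: cvg_big => [|i _]; first exact: add_continuous.
exact: cvg_grid_fun.
Qed.

(** The extension lives on the whole space: beyond the unit sphere all clamps equal 1 and it is [f]
    after [normalize]. *)
Lemma uniformity_complex_sphere_extension (R : realType) (E : finType)
    (M : matroid E) (S : {set E}) (n : nat) (f : 'rV[R]_n -> {ptws E -> R}) :
  uniform_subset M S -> (matroid_rank M * 2 ^ (2 * 3 ^ n) < #|S|)%N ->
  {within unit_sphere R n, continuous f} ->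
  (forall x, unit_sphere R n x -> realization R (uniformity_complex M) (f x)) ->
  exists g : 'rV[R]_n -> {ptws E -> R},
    [/\ continuous g, forall x, realization R (uniformity_complex M) (g x) &
        forall x, unit_sphere R n x -> g x = f x].
Proof.
move=> uS lS fc fK.
have [v0 v0S] : exists v, v \in S.
  by apply/finset.set0Pn; rewrite -card_gt0; apply: leq_ltn_trans lS.
have E0 : 0 < #|E|%:R :> R by rewrite ltr0n; apply/card_gt0P; exists v0.
have EV0 : 0 < #|E|%:R^-1 :> R by rewrite invr_gt0.
(* Some barycentric coordinate of any point is at least [1 / #|E|]. With this tolerance it stays
   non-zero across the part of the sphere in the support of a grid function. *)
have [m m0 fm] := unit_sphere_unif_continuous EV0 fc.
pose phi := @grid_fun R n m.
have phi0 z x : 0 <= phi z x by exact: grid_fun_ge0.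
have phi1 x : unit_sphere R n x -> \sum_z phi z x = 1.
  by move=> xS; apply: sum_grid_fun => j; exact: unit_sphere_coord.
have /choice[w wP] : forall z, exists v, forall x, unit_sphere R n x ->
    phi z x != 0 -> f x v != 0.
  move=> z; have [[x0 x0S zx0]|nx] :=
      pselect (exists2 x, unit_sphere R n x & phi z x != 0); last first.
    (* The support of this grid function misses the sphere, so any vertex will do. *)
    by exists v0 => x xS zx; case: nx; exists x.
  have [f0 f1 _] := fK _ x0S.
  have [v vE] : exists v, #|E|%:R^-1 <= f x0 v.
    apply: contrapT => /forallNP nv; have : \sum_e f x0 e < 1.
      have -> : 1 = \sum_(e : E) #|E|%:R^-1 :> R.
        by rewrite sumr_const -[_^-1 *+ _]mulr_natr mulVf // lt0r_neq0.
      apply: ltr_sum => [|e _].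
        by apply/hasP; exists v0; rewrite ?mem_index_enum.
      by rewrite ltNge; exact/negP/nv.
    by rewrite f1 ltxx.
  exists v => x xS zx.
  have := fm x0 x x0S xS (grid_fun_close m0 zx0 zx) v.
  apply: contraTneq => ->; rewrite subr0 -leNgt.
  by rewrite (le_trans vE) // ler_norm.
have [s sS sC] := uniform_clique_extension w (@card_grid_adj n m) uS lS.
pose C x : {set grid_index n m} := [set z | phi z x != 0]%SET.
have hA x : unit_sphere R n x -> in_simplex (w @: C x) (spread (phi^~ x) w).
  by move=> xS; apply: spread_in_simplex; [move=> z|exact: phi1].
have sA x : unit_sphere R n x -> in_simplex (s @: C x) (spread (phi^~ x) s).
  by move=> xS; apply: spread_in_simplex; [move=> z|exact: phi1].
have wf x : unit_sphere R n x -> w @: C x \subset [set e | f x e != 0]%SET.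
  move=> xS; apply/fintype.subsetP => _ /imsetP[z + ->].
  by rewrite !inE; exact: wP.
exists (filling f (fun x => spread (phi^~ x) w) (fun x => spread (phi^~ x) s)
  (vertex_point R v0)); split => [x|x|x xS]; last exact: filling_sphere.
- apply: (@cvg_ptws _ _ _ (nbhs x)) => e.
  apply: (@cvg_filling _ _ _ _ _ _ _ _ (nbhs x) _ id) => //.
  + by move=> u; exact: cvg_spread_grid.
  + by move=> u; exact: cvg_spread_grid.
  + by move=> j; exact: coord_continuous.
- apply: (@filling_realization _ _ _ _ _ _ _ _ S) => //.
  + apply: in_simplexS (vertex_point_in_simplex R v0).
    by rewrite finset.sub1set.
  + move=> u uSph; apply: in_simplexS (sA _ uSph).
    by apply/fintype.subsetP => _ /imsetP[z _ ->].
  (* The indices active at [u] are pairwise adjacent, and their [w] vertices span a face inside the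
     support of [f u]. *)
  + move=> u uSph; exists (w @: C u :|: s @: C u)%SET.
      apply: sC => [z z'|]; first by rewrite !inE; exact: grid_fun_adj.
      by have [_ _] := fK _ uSph; exact: face_subset (wf _ uSph).
    split; [apply: in_simplexS (sA _ uSph); exact: finset.subsetUr|].
    by apply: in_simplexS (hA _ uSph); exact: finset.subsetUl.
  + move=> u uSph; exists [set e | f u e != 0]%SET.
      by have [] := fK _ uSph.
    split; last exact: realization_in_simplex (fK _ uSph).
    by apply: in_simplexS (hA _ uSph); exact: wf.
Qed.

Theorem theorem5p1 (R : realType) (r : nat) (k : int) :
  (2 <= r)%N -> -1 <= k ->
  exists N : nat, (0 < N)%N /\
    forall (E : finType) (M : matroid E),
      loopless M -> matroid_rank M = r -> (N <= mu M)%N ->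
      k_connected R k (realization R (uniformity_complex M)).
Proof.
(* A sphere of dimension [i <= k] sits in a space of dimension [i + 1], at most [|k| + 1], where
   grid points have at most [3 ^ (i + 1)] neighbours. *)
move=> _ _; exists (r * 2 ^ (2 * 3 ^ `|k|.+1)).+1; split => // E M _ rM NM.
have [S uS lS] : exists2 S : {set E}, uniform_subset M S &
    (r * 2 ^ (2 * 3 ^ `|k|.+1) < #|S|)%N.
  (* The maximum is attained because the empty set is uniform. *)
  have [S uS muS] : {S | uniform_subset M S & mu M = #|S|}.
    apply: (@eq_bigmax_cond _ (uniform_subset M)).
    apply/card_gt0P; exists finset.set0; rewrite unfold_in.
    by apply/orP; left; exact: indep_set0.
  by exists S => //; rewrite -muS.
split=> [_|i ik f fc fK].
  have [v vS] : exists v, v \in S.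
    by apply/finset.set0Pn; rewrite -card_gt0; apply: leq_ltn_trans lS.
  exists (vertex_point R v).
  apply: in_simplex_realization (vertex_point_in_simplex R v).
  by apply: uniform_subsetS uS; rewrite finset.sub1set.
have [|g [gc gK gf]] := uniformity_complex_sphere_extension uS _ fc fK.
  rewrite rM; apply: leq_ltn_trans lS.
  rewrite leq_mul2l leq_exp2l // leq_mul2l leq_exp2l // ltnS.
  by apply/orP; right; lia.
by exists g; split => //; exact: continuous_subspaceT.
Qed.
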